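(* Let $n\ge 1$, let $\Phi$ be a norm on $\mathbb{R}^n$, and let $S\subseteq\mathbb{R}^n$ be a finite set of unit vectors (i.e. $\Phi(x)=1$ for all $x\in S$) such that $$\Phi\Big(\sum_{x\in J}x\Big)\le 1\quad\text{for all } J\subseteq S.$$ Then $|S|\le 2n$. Moreover, $|S|=2n$ if and only if $(\mathbb{R}^n,\Phi)$ is linearly isometric to $\ell^n_\infty$, with $S$ corresponding to the set $\{\pm e_i : 1\le i\le n\}$ under any linear isometry, i.e. if and only if there exists a linear isometry from $(\mathbb{R}^n,\Phi)$ onto $\ell^n_\infty$, and every linear isometry $L$ from $(\mathbb{R}^n,\Phi)$ onto $\ell^n_\infty$ satisfies $L(S)=\{\pm e_i : 1\le i\le n\}$.
   Context: $\ell^n_\infty$ denotes $\mathbb{R}^n$ with the norm $\Phi_\infty(x)=\max_{1\le i\le n}|x(i)|$, where $x=(x(1),\dots,x(n))$. The vectors $e_1,\dots,e_n$ are the standard basis of $\mathbb{R}^n$. A linear isometry from $(\mathbb{R}^n,\Phi)$ onto $\ell^n_\infty$ is a linear bijection $L:\mathbb{R}^n\to\mathbb{R}^n$ with $\Phi_\infty(Lx)=\Phi(x)$ for all $x$. *)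

(* Defs.v *)
From HB Require Import structures.
From mathcomp Require Import all_boot all_order all_algebra finmap.
From mathcomp Require Import reals normedtype.

Set Implicit Arguments.
Unset Strict Implicit.
Unset Printing Implicit Defensive.

Import Order.TTheory GRing.Theory Num.Theory numFieldNormedType.Exports.

Local Open Scope fset_scope.
Local Open Scope ring_scope.

(* An arbitrary norm is a function satisfying this predicate, not an instance
   on 'rV[R]_n, because that type already carries the canonical norm mx_norm. *)
Record is_norm (R : realType) (n : nat) (Phi : 'rV[R]_n -> R) : Prop := IsNorm {
  is_norm_ge0 : forall x : 'rV[R]_n, 0 <= Phi x ;
  is_norm_eq0 : forall x : 'rV[R]_n, Phi x = 0 -> x = 0 ;
  is_norm_scale : forall (a : R) (x : 'rV[R]_n), Phi (a *: x) = `|a| * Phi x ;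
  is_norm_triangle : forall x y : 'rV[R]_n, Phi (x + y) <= Phi x + Phi y
}.

(* The canonical norm `|_| of 'rV[R]_n is mx_norm, that is the maximum of the
   absolute values of the coordinates (mx_normrE), so that 'rV[R]_n with this
   norm is l_infty^n. *)
Definition linfty_isometry (R : realType) (n : nat) (Phi : 'rV[R]_n -> R)
    (L : {linear 'rV[R]_n -> 'rV[R]_n}) : Prop :=
  bijective L /\ forall x, `|L x| = Phi x.

Definition pm_basis (R : realType) (n : nat) : {fset 'rV[R]_n} :=
  [fset delta_mx 0 i | i in 'I_n] `|` [fset - delta_mx 0 i | i in 'I_n].

(* Main.v *)
(* Take a norming functional f_x for every x in S. The hypothesis on the sums of
   pairs, and on the sum of S minus x, says that the matrix f_x(y) has unit
   diagonal, nonpositive entries elsewhere and nonnegative row sums. Given a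
   total order on S, let T be the set of x with a positive row sum or with some
   y > x such that f_x(y) < 0. By a maximum principle the vectors in T are
   linearly independent, so T has at most n elements, and S is covered by T and
   the analogous set for the reverse order, so |S| <= 2n.

   If |S| = 2n, the two sets are disjoint and have exactly n elements for every
   order. Choosing suitable orders, one finds that each x has a single partner y
   with f_x(y) <> 0, that f_x(y) = -1, that the partner of y is x, and that
   y = -x. Hence S consists of the vectors of a basis and their opposites, with
   the f_x as coordinates up to sign, and Phi is the maximum norm in this basis.
   Finally, n unit vectors of l_infty^n all of whose signed sums have norm at
   most 1 are the standard basis up to order and signs. *)
Require Import Defs.
From HB Require Import structures.
From mathcomp Require Import classical_sets.
From mathcomp Require Import all_boot all_order all_algebra finmap.
From mathcomp Require Import reals normedtype.
From mathcomp Require Import zify ring lra.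

Set Implicit Arguments.
Unset Strict Implicit.
Unset Printing Implicit Defensive.

Import Order.TTheory GRing.Theory Num.Theory numFieldNormedType.Exports.

Local Open Scope ring_scope.

(** * Norming functionals *)

Section HahnBanach.
Variables (R : realType) (V : lmodType R).
Implicit Types (p q : V -> R) (u v x y : V).

Definition sublinear p :=
  (forall x y, p (x + y) <= p x + p y) /\
  (forall a x, 0 <= a -> p (a *: x) <= a * p x).

Lemma sublinear0 p : sublinear p -> p 0 = 0.
Proof.
move=> [pD pZ]; apply/eqP; rewrite eq_le; apply/andP; split.
  by have := pZ 0 0 (lexx 0); rewrite scale0r mul0r.
by have := pD 0 0; rewrite addr0; lra.
Qed.

Lemma sublinearZ p a x : sublinear p -> 0 <= a -> p (a *: x) = a * p x.
Proof.
move=> sp; rewrite le_eqVlt => /orP[/eqP<-|a0].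
  by rewrite scale0r mul0r sublinear0.
apply/eqP; rewrite eq_le (sp.2 _ _ (ltW a0)) /=.
have /(sp.2 _ (a *: x)) : 0 <= a^-1 by rewrite invr_ge0 ltW.
rewrite scalerA mulVf ?gt_eqF // scale1r => px; rewrite mulrC -ler_pdivlMr //.
by rewrite mulrC.
Qed.

(* The minorant is q(x) = inf_(t >= 0) (p(x + t v) - t p(v)). *)
Lemma sublinear_minorant p v : sublinear p ->
  exists q, [/\ sublinear q, forall x, q x <= p x & q (- v) <= - p v].
Proof.
move=> sp; have [pD pZ] := sp.
pose A u : set R :=
  [set r | exists2 t, 0 <= t & r = p (u + t *: v) - t * p v]%classic.
have lbA u : lbound (A u) (- p (- u)).
  move=> _ [t t0 ->]; rewrite -(sublinearZ v sp t0).
  have := pD (u + t *: v) (- u); rewrite addrAC subrr add0r; lra.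
have A0 u : (A u !=set0)%classic by exists (p (u + 0 *: v) - 0 * p v), 0.
have qle u t : 0 <= t -> inf (A u) <= p (u + t *: v) - t * p v.
  by move=> t0; apply: ge_inf; [exists (- p (- u)) | exists t].
exists (fun u => inf (A u)); split; first split.
- move=> x y; rewrite -lerBlDr; apply: lb_le_inf => // _ [t t0 ->].
  rewrite lerBlDr -lerBlDl; apply: lb_le_inf => // _ [s s0 ->].
  have := qle (x + y) (t + s) (addr_ge0 t0 s0).
  have := pD (x + t *: v) (y + s *: v).
  rewrite addrACA -scalerDl; lra.
- move=> a x; rewrite le_eqVlt => /orP[/eqP<-|a0].
    rewrite scale0r mul0r; have := qle 0 0 (lexx _).
    by rewrite scale0r addr0 sublinear0 // mul0r subr0.
  rewrite mulrC -ler_pdivrMr //; apply: lb_le_inf => // _ [t t0 ->].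
  rewrite ler_pdivrMr //.
  have := qle (a *: x) (a * t) (mulr_ge0 (ltW a0) t0).
  rewrite -scalerA -scalerDr (sublinearZ _ sp (ltW a0)); lra.
- by move=> x; have := qle x 0 (lexx _); rewrite scale0r addr0 mul0r subr0.
- by have := qle (- v) 1 ler01; rewrite scale1r addNr sublinear0 // mul1r sub0r.
Qed.

(** Earlier inequalities survive a further step: if q' <= q, then q'(-w) <= q(-w) <= -q(w) <=
    -q'(w). *)
Lemma sublinear_minorant_seq p (s : seq V) : sublinear p ->
  exists q, [/\ sublinear q, forall x, q x <= p x &
    forall v, v \in s -> q (- v) <= - q v].
Proof.
move=> sp; elim: s => [|v s [q [sq qp qs]]]; first by exists p.
have [q' [sq' q'q q'v]] := sublinear_minorant v sq.
exists q'; split=> // [x|w]; first exact: le_trans (qp x).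
rewrite inE => /orP[/eqP->|/qs qw].
  by apply: le_trans q'v _; rewrite lerN2.
by apply: le_trans (q'q _) _; apply: le_trans qw _; rewrite lerN2.
Qed.

End HahnBanach.

Definition dot_form (R : realType) n (w : 'cV[R]_n) (u : 'rV[R]_n) : R :=
  (u *m w) 0 0.

Fact dot_form_linear (R : realType) n (w : 'cV[R]_n) : scalar (dot_form w).
Proof. by move=> a u v; rewrite /dot_form mulmxDl -scalemxAl !mxE. Qed.

HB.instance Definition _ (R : realType) n (w : 'cV[R]_n) :=
  GRing.isLinear.Build R 'rV[R]_n R _ (dot_form w) (dot_form_linear w).

Section Norm.
Variables (R : realType) (n : nat) (Phi : 'rV[R]_n -> R).
Hypothesis Phi_norm : is_norm Phi.

Lemma is_norm_sublinear : sublinear Phi.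
Proof.
split; first exact: is_norm_triangle.
by move=> a x a0; rewrite is_norm_scale // ger0_norm.
Qed.

Lemma is_normN x : Phi (- x) = Phi x.
Proof. by rewrite -scaleN1r is_norm_scale // normrN1 mul1r. Qed.

(* Once q(-v) <= -q(v) holds for all basis vectors v, the sublinear map q is
   linear. *)
Lemma norming_functional x : exists f : {scalar 'rV[R]_n},
  f x = Phi x /\ forall u, f u <= Phi u.
Proof.
(* Treating x first gives [q0 (- x) <= - Phi x], which later minorants inherit and which yields
   [Phi x <= f x]. *)
have [q0 [sq0 q0P q0x]] := sublinear_minorant x is_norm_sublinear.
have [q [sq qq0 qe]] :=
  sublinear_minorant_seq [seq delta_mx 0 i | i <- enum 'I_n] sq0.
pose f : {scalar 'rV[R]_n} := dot_form (\col_i q (delta_mx 0 i)).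
have fE u : f u = \sum_i u 0 i * q (delta_mx 0 i).
  by rewrite /f /= /dot_form mxE; apply: eq_bigr => i _; rewrite mxE.
have q_sum (F : 'I_n -> 'rV[R]_n) : q (\sum_i F i) <= \sum_i q (F i).
  elim/big_rec2: _ => [|i a b _ le_ba]; first by rewrite sublinear0.
  by apply: le_trans (sq.1 _ _) _; rewrite lerD2l.
have qle u : q u <= f u.
  rewrite fE [u in q u]row_sum_delta; apply: le_trans (q_sum _) _.
  apply: ler_sum => i _; have [u0|/ltW u0] := lerP 0 (u 0 i).
    by rewrite sublinearZ.
  rewrite -[u 0 i]opprK scaleNr -scalerN sublinearZ ?oppr_ge0 //.
  rewrite [leRHS]mulNr -mulrN.
  by apply: ler_wpM2l; rewrite ?oppr_ge0 // qe // map_f // mem_enum.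
have fle u : f u <= q u.
  have := qle (- u); rewrite linearN; have := sq.1 u (- u).
  rewrite subrr sublinear0 //; lra.
have fP u : f u <= Phi u by apply: le_trans (fle u) (le_trans (qq0 u) (q0P u)).
exists f; split=> //; apply/eqP; rewrite eq_le fP /=.
have := le_trans (fle (- x)) (le_trans (qq0 _) q0x).
by rewrite linearN lerN2.
Qed.

(** A convex function on a cube is bounded by its values at the vertices. The induction is on the
    number k of coordinates allowed to lie inside [-1, 1]. *)
Lemma norm_cube_le1 (b : 'I_n -> 'rV[R]_n) :
  (forall e : 'I_n -> R, (forall i, `|e i| = 1) ->
     Phi (\sum_i e i *: b i) <= 1) ->
  forall c : 'I_n -> R, (forall i, `|c i| <= 1) ->
  Phi (\sum_i c i *: b i) <= 1.
Proof.
move=> vertices c c1.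
suff cube k (d : 'I_n -> R) : (forall i, `|d i| <= 1) ->
    (forall i : 'I_n, (k <= i)%N -> `|d i| = 1) -> Phi (\sum_i d i *: b i) <= 1.
  by apply: (cube n) => // i; rewrite leqNgt ltn_ord.
elim: k d => [|k IH] d d1 dk; first by apply: vertices => i; exact: dk.
have [kn|nk] := ltnP k n; last first.
  by apply: IH => // i /(leq_trans nk); rewrite leqNgt ltn_ord.
pose j := Ordinal kn; pose d_ s i := if i == j then s else d i.
have Phi_d_ s : `|s| = 1 -> Phi (\sum_i d_ s i *: b i) <= 1.
  move=> s1; apply: IH => i; rewrite /d_; case: eqVneq => //; first by rewrite s1.
  by move=> ij ki; apply: dk; rewrite ltn_neqAle ki andbT eq_sym.
have /andP[dj1 dj2] : -1 <= d j <= 1 by rewrite -ler_norml.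
have -> : \sum_i d i *: b i = ((1 + d j) / 2) *: (\sum_i d_ 1 i *: b i) +
    ((1 - d j) / 2) *: (\sum_i d_ (-1) i *: b i).
  rewrite !scaler_sumr -big_split; apply: eq_bigr => i _ /=.
  rewrite !scalerA -scalerDl /d_; congr (_ *: _).
  by case: eqVneq => [->|_]; field.
apply: le_trans (is_norm_triangle Phi_norm _ _) _.
rewrite !is_norm_scale // !ger0_norm; [|lra|lra].
have /Phi_d_ a1 : `|1 : R| = 1 by rewrite normr1.
have /Phi_d_ a2 : `|-1 : R| = 1 by rewrite normrN1.
nra.
Qed.

End Norm.

(** * Systems of norming functionals *)

Section NormingSystem.
Variables (R : realFieldType) (n : nat) (I : finType).
Variables (v : I -> 'rV[R]_n) (f : I -> {scalar 'rV[R]_n}).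
Hypothesis f_diag : forall x, f x (v x) = 1.
Hypothesis f_le0 : forall x y, y != x -> f x (v y) <= 0.
Hypothesis f_sum : forall x, -1 <= \sum_(y | y != x) f x (v y).
Implicit Types (h : I -> R) (x y : I).

(** The order is encoded by a real function h, so that negating h reverses it; the first alternative
    does not depend on h. *)
Definition ascents h := [set x | (-1 < \sum_(y | y != x) f x (v y)) ||
  [exists y, (f x (v y) < 0) && (h x < h y)]].

(* Maximum principle: among the x maximizing |c x| take one with h x maximal;
   there, row x of the system cannot vanish unless c = 0. *)
Lemma ascents_free h (c : I -> R) :
  (forall x, x \notin ascents h -> c x = 0) ->
  (forall x, x \in ascents h -> f x (\sum_y c y *: v y) = 0) ->
  forall x, c x = 0.
Proof.
move=> c_out c_in x1; apply/eqP/negP => /negP cx1.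
have [x2 _ c_max] := @arg_maxP _ R I x1 predT (fun x => `|c x|) erefl.
have [x /eqP cx h_max] :=
  @arg_maxP _ R I x2 (fun x => `|c x| == `|c x2|) h (eqxx _).
have {x2 cx c_max h_max} [c_max h_max] : (forall y, `|c y| <= `|c x|) /\
    (forall y, `|c y| = `|c x| -> h y <= h x).
  rewrite cx; split=> y; first exact: c_max.
  by move=> cy; apply: h_max; apply/eqP.
have M_gt0 : 0 < `|c x| by apply: lt_le_trans (c_max x1); rewrite normr_gt0.
have xT : x \in ascents h.
  by apply: contraLR M_gt0 => /c_out ->; rewrite normr0 ltxx.
have := c_in x xT; rewrite linear_sum (bigD1 x) //= linearZ /= f_diag mulr1.
move=> /eqP; rewrite addr_eq0 => /eqP cxE.
have cxle : `|c x| <= \sum_(y | y != x) `|c y| * - f x (v y).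
  rewrite {1}cxE normrN; apply: le_trans (ler_norm_sum _ _ _) _.
  apply: ler_sum => y yx.
  by rewrite linearZ /= normrM (ler0_norm (f_le0 yx)).
have term_ge0 y : y != x -> 0 <= (`|c x| - `|c y|) * - f x (v y).
  by move=> yx; rewrite mulr_ge0 ?subr_ge0 ?oppr_ge0 ?f_le0.
have sum_ge0 : 0 <= \sum_(y | y != x) (`|c x| - `|c y|) * - f x (v y).
  exact: sumr_ge0.
(* By [f_sum] and [cxle] the right-hand side is at most 0. Slack in row x makes it negative, while
   an ascent to y makes the left-hand side positive. *)
have sumE : \sum_(y | y != x) (`|c x| - `|c y|) * - f x (v y) =
    - (`|c x| * \sum_(y | y != x) f x (v y)) -
    \sum_(y | y != x) `|c y| * - f x (v y).
  rewrite mulr_sumr -!sumrN -big_split /=; apply: eq_bigr => y _; ring.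
have fx := f_sum x.
move: xT; rewrite inE => /orP[slack|/existsP[y /andP[fy hy]]].
  by rewrite sumE in sum_ge0; nra.
have yx : y != x by apply: contraTneq hy => ->; rewrite ltxx.
have cy : `|c y| < `|c x|.
  rewrite lt_neqAle c_max andbT; apply: contraTneq hy => /h_max.
  by rewrite -leNgt.
have rest : 0 <= \sum_(z | (z != x) && (z != y)) (`|c x| - `|c z|) * - f x (v z).
  by apply: sumr_ge0 => z /andP[/term_ge0].
move: sumE; rewrite (bigD1 y) //=.
have : 0 < (`|c x| - `|c y|) * - f x (v y).
  by rewrite mulr_gt0 ?subr_gt0 ?oppr_gt0.
nra.
Qed.

Definition ascent_mx h : 'M[R]_(#|ascents h|, n) := \matrix_i v (enum_val i).

(** Links matrix rank to the maximum principle: coefficients on the ascents are extended by zero to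
    [I]. *)
Lemma ascent_comb h (w : 'rV[R]_#|ascents h|) : exists c : I -> R,
  [/\ forall x, x \notin ascents h -> c x = 0,
      forall i, c (enum_val i) = w 0 i &
      w *m ascent_mx h = \sum_x c x *: v x].
Proof.
exists (fun x => \sum_(i | enum_val i == x) w 0 i); split.
- move=> x xT; rewrite big1 // => i /eqP ix.
  by rewrite -ix enum_valP in xT.
- move=> i; rewrite (big_pred1 i) // => j /=.
  by rewrite (inj_eq enum_val_inj).
- rewrite mulmx_sum_row (partition_big enum_val predT) //=.
  apply: eq_bigr => x _; rewrite scaler_suml; apply: eq_bigr => i /eqP <-.
  by rewrite rowK.
Qed.

Lemma ascent_mx_free h : row_free (ascent_mx h).
Proof.
apply: inj_row_free => w w0; have [c [c_out cw cE]] := ascent_comb w.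
apply/rowP => i; rewrite mxE -cw; apply: (ascents_free c_out) => x _.
by rewrite -cE w0 linear0.
Qed.

Lemma card_ascents h : (#|ascents h| <= n)%N.
Proof. by move: (ascent_mx_free h) => /eqP <-; exact: rank_leq_col. Qed.

(** A row without slack sums to -1, so it has a negative entry at some y, and [h y] lies above or
    below [h x]. *)
Lemma ascents_cover h : injective h ->
  ascents h :|: ascents (fun x => - h x) = setT.
Proof.
move=> h_inj; apply/setP => x; rewrite !inE.
case: ltP => //= /(conj (f_sum x)) /andP /le_anti sumE.
have [y /andP[yx fy]] : exists y, (y != x) && (f x (v y) < 0).
  apply/existsP; apply: contraPT sumE => /existsPn f0.
  rewrite big1 => [/eqP|y yx]; first by rewrite oppr_eq0 oner_eq0.
  by apply/eqP; rewrite eq_le f_le0 //=; have := f0 y; rewrite yx /= -leNgt.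
have : h x != h y by rewrite (inj_eq h_inj) eq_sym.
rewrite neq_lt => /orP[] hxy; apply/orP; [left|right];
  by apply/existsP; exists y; rewrite fy // ltrN2.
Qed.

(** Lets the two lowest places be prescribed: exchanging a and b leaves all other ranks unchanged.
    The shift by 2 keeps the ranks distinct. *)
Definition front_rank (a b x : I) : nat :=
  if x == a then 0 else if x == b then 1 else (enum_rank x).+2.

Definition front_order a b x : R := (front_rank a b x)%:R.

Lemma front_order_inj a b : injective (front_order a b).
Proof.
move=> x y /eqP; rewrite eqr_nat /front_rank => /eqP.
case: (x =P a); case: (y =P a); case: (x =P b); case: (y =P b) => //;
  try congruence.
by move=> _ _ _ _ [/val_inj/enum_rank_inj].
Qed.

Lemma rank_order_inj : injective (fun x : I => (enum_rank x)%:R : R).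
Proof. by move=> x y /eqP; rewrite eqr_nat => /eqP /val_inj /enum_rank_inj. Qed.

Lemma card_norming_system : (#|I| <= 2 * n)%N.
Proof.
rewrite -cardsT -(ascents_cover rank_order_inj).
by rewrite (leq_trans (leq_card_setU _ _)) // mul2n -addnn leq_add ?card_ascents.
Qed.

(** * The equality case: partners and a basis *)

Section Extremal.
Hypothesis cardI : #|I| = (2 * n)%N.

(** Two sets of at most n elements cover 2n elements, so both have size n and they cannot
    overlap. *)
Lemma extremal_ascents h : injective h ->
  #|ascents h| = n /\ [disjoint ascents h & ascents (fun x => - h x)].
Proof.
move=> h_inj; have := cardsUI (ascents h) (ascents (fun x => - h x)).
rewrite ascents_cover // cardsT cardI.
have := card_ascents h; have := card_ascents (fun x => - h x).
move=> le1 le2 e; rewrite -setI_eq0 -cards_eq0.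
by split; [|apply/eqP]; lia.
Qed.

(** A row with slack would be an ascent for an order and for its reverse, against disjointness. *)
Lemma extremal_tight x : \sum_(y | y != x) f x (v y) = -1.
Proof.
have [_ /pred0P/(_ x)] := extremal_ascents (@front_order_inj x x).
rewrite /= !inE; case: ltP => //= fx _.
by apply/eqP; rewrite eq_le fx f_sum.
Qed.

(* Otherwise x would be an ascent both for an order with y < x < z and for its
   reverse. *)
Lemma extremal_neg_unique x y z : f x (v y) < 0 -> f x (v z) < 0 -> y = z.
Proof.
move=> fy fz; apply: contraTeq isT => yz.
have neq t : f x (v t) < 0 -> t != x.
  by apply: contraTneq => ->; rewrite f_diag -leNgt.
have [_ /pred0P/(_ x)] := extremal_ascents (@front_order_inj y x).
rewrite /= !inE => /negP[]; apply/andP; split; apply/orP; right.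
  apply/existsP; exists z; rewrite fz.
  rewrite ltr_nat /front_rank eqxx [x == y]eq_sym (negbTE (neq _ fy)).
  by rewrite [z == y]eq_sym (negbTE yz) (negbTE (neq _ fz)).
apply/existsP; exists y; rewrite fy ltrN2 ltr_nat /front_rank.
by rewrite !eqxx [x == y]eq_sym (negbTE (neq _ fy)).
Qed.

Lemma extremal_partner x : exists y,
  [/\ y != x, f x (v y) = -1 & forall z, z != x -> z != y -> f x (v z) = 0].
Proof.
have [y /andP[yx fy]] : exists y, (y != x) && (f x (v y) < 0).
  apply/existsP; apply: contraPT (extremal_tight x) => /existsPn f0.
  rewrite big1 => [/eqP|y yx]; first by rewrite eq_sym oppr_eq0 oner_eq0.
  by apply/eqP; rewrite eq_le f_le0 //=; have := f0 y; rewrite yx /= -leNgt.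
have fz z : z != x -> z != y -> f x (v z) = 0.
  move=> zx zy; apply/eqP; rewrite eq_le f_le0 //= leNgt.
  by apply: contra zy => /extremal_neg_unique/(_ fy) ->.
exists y; split=> //; rewrite -(extremal_tight x) (bigD1 y) //=.
by rewrite big1 ?addr0 // => z /andP[zx zy]; exact: fz.
Qed.

Section Partner.
Variable g : I -> I.
Hypothesis gP : forall x,
  [/\ g x != x, f x (v (g x)) = -1 &
      forall z, z != x -> z != g x -> f x (v z) = 0].

Lemma extremal_ascentsE h x : (x \in ascents h) = (h x < h (g x)).
Proof.
have [gx fgx _] := gP x; rewrite inE extremal_tight ltxx /=.
apply/existsP/idP => [[y /andP[fy hy]]|hx]; last first.
  by exists (g x); rewrite fgx ltrN10.
by rewrite (@extremal_neg_unique x (g x) y) // fgx ltrN10.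
Qed.

(* Exchanging x and y = g x at the front of the order turns x from an ascent
   into a descent and, if g y <> x, leaves y an ascent, so the number of ascents
   could not be n for both orders. *)
Lemma partnerK : involutive g.
Proof.
move=> x; apply/eqP; apply: contraT => ggx; set y := g x in ggx *.
have [gx _ _] := gP x; have [gy _ _] := gP y; rewrite -/y in gx.
have [c1 _] := extremal_ascents (@front_order_inj x y).
have [c2 _] := extremal_ascents (@front_order_inj y x).
suff : (#|ascents (front_order y x)| < #|ascents (front_order x y)|)%N.
  by rewrite c1 c2 ltnn.
apply: proper_card; apply/properP; split; last first.
  exists x; rewrite extremal_ascentsE ltr_nat /front_rank -/y !eqxx.
    by rewrite (negbTE gx).
  by rewrite [x == y]eq_sym (negbTE gx).
apply/subsetP => z; rewrite !extremal_ascentsE !ltr_nat /front_rank.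
have [->|zx] := eqVneq z x; first by rewrite -/y eqxx eq_sym (negbTE gx).
have [->|zy] := eqVneq z y; first by rewrite (negbTE ggx) (negbTE gy).
(* Here z ranks above both x and y, so it is an ascent for neither order if [g z] is x or y. *)
by case: (g z == x); case: (g z == y).
Qed.

(** The n ascents give a basis, and every [f y] kills [v x + v (g x)]: the two values are 1 and -1
    if y is x or its partner, and 0 otherwise. The maximum principle then makes all coefficients
    vanish. *)
Lemma partner_opp x : v (g x) = - v x.
Proof.
have [cT _] := extremal_ascents (@front_order_inj x x).
set h := front_order x x in cT.
have full : row_full (ascent_mx h).
  by rewrite /row_full; have /eqP -> := ascent_mx_free h; rewrite cT.
have /submxP[w wE] : ((v x + v (g x))%R <= ascent_mx h)%MS by apply: submx_full.
have [c [c_out _ cE]] := ascent_comb w; rewrite cE in wE.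
have c0 : forall y, c y = 0.
  apply: (ascents_free c_out) => y _; rewrite -wE linearD /=.
  have [gx fgx fx] := gP x; have [gy fgy fy] := gP y.
  have [->|yx] := eqVneq y x; first by rewrite f_diag fgx subrr.
  have [->|ygx] := eqVneq y (g x).
    by have [_ + _] := gP (g x); rewrite partnerK f_diag => ->; rewrite addNr.
  rewrite !fy ?addr0 // eq_sym //; first by rewrite (inj_eq (inv_inj partnerK)).
  by apply: contra ygx => /eqP <-; rewrite partnerK.
apply/eqP; rewrite -addr_eq0 addrC wE big1 // => y _.
by rewrite c0 scale0r.
Qed.

End Partner.

(** Exactly one of x and [g x] is an ascent, so the n ascents of a fixed order represent the n pairs
    of opposite vectors. *)
Lemma extremal_basis : exists b : 'I_n -> I,
  [/\ forall i j, f (b i) (v (b j)) = (i == j)%:R,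
      forall x, exists i, v x = v (b i) \/ v x = - v (b i) &
      forall i, exists x, v x = - v (b i)].
Proof.
have [g gP] := fin_all_exists extremal_partner.
have gK := partnerK gP; have gN := partner_opp gP.
have [cT _] := extremal_ascents rank_order_inj.
set h := (fun x : I => _) in cT.
have TE x : (x \in ascents h) = (h x < h (g x)) := extremal_ascentsE gP h x.
pose b (i : 'I_n) := enum_val (cast_ord (esym cT) i).
have b_inj : injective b by move=> i j /enum_val_inj /cast_ord_inj.
have bT i : b i \in ascents h by exact: enum_valP.
have b_onto x : x \in ascents h -> exists i, x = b i.
  move=> xT; exists (cast_ord cT (enum_rank_in xT x)).
  by rewrite /b cast_ordK enum_rankK_in.
exists b; split.
- move=> i j; have [->|ij] := eqVneq i j; first exact: f_diag.
  have [_ _ -> //] := gP (b i); first by rewrite (inj_eq b_inj) eq_sym.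
  apply: contraTneq (bT j) => bj.
  by rewrite TE bj gK -leNgt ltW // -TE.
- move=> x; have [/b_onto[i ->]|] := boolP (x \in ascents h).
    by exists i; left.
  rewrite TE -leNgt => hx; have /b_onto[i gxE] : g x \in ascents h.
    rewrite TE gK lt_neqAle hx andbT (inj_eq rank_order_inj).
    by have [] := gP x.
  by exists i; right; rewrite -gxE gN opprK.
- by move=> i; exists (g (b i)); rewrite gN.
Qed.

End Extremal.
End NormingSystem.

(** * The maximum norm *)

Section MaxNorm.
Variables (R : realType) (n : nat).
Implicit Types c : 'rV[R]_n.

Lemma coord_le_norm c i : `|c 0 i| <= `|c|.
Proof.
by rewrite [leRHS]/Num.Def.normr /= mx_normrE; apply: (le_bigmax _ _ (0, i)).
Qed.

Lemma row_norm_le c a : 0 <= a -> (forall i, `|c 0 i| <= a) -> `|c| <= a.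
Proof.
move=> a0 ca; rewrite [leLHS]/Num.Def.normr /= mx_normrE.
by apply: bigmax_le => // -[j i] _ /=; rewrite ord1.
Qed.

Lemma row_norm_attained c : c != 0 -> exists i, `|c 0 i| = `|c|.
Proof.
rewrite -normr_eq0 => /mx_norm_neq0[[j i] /= ci].
by exists i; rewrite [in RHS]/Num.Def.normr /= ci ord1.
Qed.

(* Choosing the signs e i against a fixed coordinate k shows that the k-th
   coordinates of the m i have absolute sum at most 1. *)
Lemma unit_rows_signed_perm (m : 'I_n -> 'rV[R]_n) :
  (forall i, `|m i| = 1) ->
  (forall e : 'I_n -> R, (forall i, `|e i| = 1) -> `|\sum_i e i *: m i| <= 1) ->
  exists s : 'I_n -> 'I_n, injective s /\
    forall i, m i = delta_mx 0 (s i) \/ m i = - delta_mx 0 (s i).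
Proof.
move=> m1 signs.
have col_sum k : \sum_i `|m i 0 k| <= 1.
  pose e i : R := if 0 <= m i 0 k then 1 else -1.
  have e1 i : `|e i| = 1 by rewrite /e; case: ifP; rewrite ?normrN normr1.
  apply: le_trans (signs e e1); apply: le_trans (coord_le_norm _ k).
  rewrite summxE; apply: le_trans (ler_norm _); apply: ler_sum => i _.
  rewrite mxE /e; have [ge0|lt0] := lerP 0 (m i 0 k).
    by rewrite mul1r ger0_norm.
  by rewrite mulN1r ltr0_norm.
have [s sP] : exists s : 'I_n -> 'I_n, forall i, `|m i 0 (s i)| = 1.
  apply: (@fin_all_exists _ _ (fun i k => `|m i 0 k| = 1)) => i.
  rewrite -(m1 i); apply: row_norm_attained.
  by rewrite -normr_eq0 m1 oner_eq0.
(* Column [s i] already has an entry of absolute value 1, which uses up its sum. *)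
have m_off i j : j != i -> m j 0 (s i) = 0.
  move=> ji; have := col_sum (s i); rewrite (bigD1 i) //= sP gerDl => le0.
  apply/eqP; rewrite -normr_le0; apply: le_trans le0.
  by rewrite (bigD1 j) //= lerDl sumr_ge0.
have s_inj : injective s.
  move=> i j sij; apply: contraTeq (oner_neq0 R) => ij.
  by rewrite -(sP j) -sij m_off ?normr0 ?eqxx // eq_sym.
have [s' _ s'K] := injF_bij s_inj.
(* As s is onto, any coordinate other than [s i] is [s j] with j <> i, where [m i] vanishes. *)
have mE i : m i = m i 0 (s i) *: delta_mx 0 (s i).
  apply/rowP => k; rewrite !mxE eqxx /= -(s'K k).
  have [->|ki] := eqVneq (s (s' k)) (s i); first by rewrite mulr1.
  by rewrite mulr0 m_off //; apply: contra_neq ki => ->.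
exists s; split=> // i; have /eqP := sP i.
rewrite eqr_norml ler01 andbT => /orP[]/eqP mi; [left|right]; rewrite mE mi.
  by rewrite scale1r.
by rewrite scaleN1r.
Qed.

End MaxNorm.

Local Open Scope fset_scope.
Local Open Scope ring_scope.

Lemma mem_pm_basis (R : realType) n (x : 'rV[R]_n) :
  reflect (exists i, x = delta_mx 0 i \/ x = - delta_mx 0 i) (x \in pm_basis R n).
Proof.
rewrite /pm_basis inE.
apply: (iffP orP) => [[/imfsetP[i _ ->]|/imfsetP[i _ ->]]|[i [->|->]]].
- by exists i; left.
- by exists i; right.
- by left; apply/imfsetP; exists i.
- by right; apply/imfsetP; exists i.
Qed.

Lemma card_pm_basis (R : realType) n : #|` pm_basis R n| = (2 * n)%N.
Proof.
have delta_inj : injective (fun i : 'I_n => delta_mx 0 i : 'rV[R]_n).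
  move=> i j /rowP/(_ i); rewrite !mxE !eqxx /=.
  by case: (i =P j) => // _ /eqP; rewrite oner_eq0.
rewrite /pm_basis cardfsU.
rewrite (_ : _ `&` _ = fset0); last first.
  apply/eqP; rewrite -[_ == _]/[disjoint _ & _].
  apply/fdisjointP => _ /imfsetP[i _ ->].
  apply/negP => /imfsetP[j _] /rowP/(_ i); rewrite !mxE !eqxx /=.
  by case: (i == j) => /= ?; lra.
rewrite cardfs0 subn0 !card_imfset //=; last by move=> i j /oppr_inj /delta_inj.
by rewrite -cardE card_ord mul2n addnn.
Qed.

(** * Sets with small subset sums *)

Section SmallSubsetSums.
Variables (R : realType) (n : nat) (Phi : 'rV[R]_n -> R) (S : {fset 'rV[R]_n}).
Hypothesis Phi_norm : is_norm Phi.
Hypothesis S_unit : forall x, x \in S -> Phi x = 1.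
Hypothesis S_sum : forall J : {fset 'rV[R]_n},
  J `<=` S -> Phi (\sum_(x <- J) x) <= 1.

Lemma norming_system : exists f : S -> {scalar 'rV[R]_n},
  [/\ forall x u, f x u <= Phi u,
      forall x, f x (val x) = 1,
      forall x y, y != x -> f x (val y) <= 0 &
      forall x, -1 <= \sum_(y | y != x) f x (val y)].
Proof.
have /fin_all_exists[f fP] : forall x : S, exists f : {scalar 'rV[R]_n},
    f (val x) = 1 /\ forall u, f u <= Phi u.
  by move=> x; rewrite -(S_unit (valP x)); exact: norming_functional.
exists f; split=> [x u|x|x y yx|x]; try by have [] := fP x.
- have [fx fle] := fP x.
  have : Phi (val x + val y) <= 1.
    have xy : val x \notin [fset val y] by rewrite inE (inj_eq val_inj) eq_sym.
    have <- : \sum_(u <- val x |` [fset val y]) u = val x + val y.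
      by rewrite big_fsetU1 // big_seq_fset1.
    apply: S_sum; apply/fsubsetP => z; rewrite !inE.
    by case/orP => /eqP ->; exact: valP.
  move=> /(le_trans (fle _)); rewrite linearD /= fx; lra.
- have [fx fle] := fP x.
  rewrite -(linear_sum (f x)) /=.
  have -> : \sum_(y : S | y != x) val y = \sum_(u <- S `\ val x) u.
    apply: (addrI (val x)); rewrite -(big_fsetD1 (val x)) ?(valP x) //=.
    by rewrite big_seq_fsetE [RHS](bigD1 x).
  rewrite lerNl -linearN; apply: le_trans (fle _) _.
  by rewrite is_normN // S_sum // fsubsetDl.
Qed.

Lemma card_small_sums : (#|` S| <= 2 * n)%N.
Proof.
have [f [_ f1 f0 fs]] := norming_system.
by rewrite cardfE; exact: (card_norming_system f1 f0 fs).
Qed.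

(** * The equality case: S and the isometries *)

Hypothesis cardS : #|` S| = (2 * n)%N.

(** The second clause turns signed sums into subset sums of S, so that [S_sum] bounds them by 1; the
    third, from the norming functionals, gives the opposite estimate. *)
Lemma extremal_cross : exists b : 'I_n -> 'rV[R]_n,
  [/\ forall x, x \in S <-> exists i, x = b i \/ x = - b i,
      forall e : 'I_n -> R, (forall i, `|e i| = 1) ->
        exists2 J, J `<=` S & \sum_i e i *: b i = \sum_(x <- J) x &
      forall (c : 'I_n -> R) i, `|c i| <= Phi (\sum_j c j *: b j)].
Proof.
have [f [fle f1 f0 fs]] := norming_system.
have cardS' : #|{: S}| = (2 * n)%N by rewrite -cardfE.
have [b [fb S_b Nb_S]] := extremal_basis f1 f0 fs cardS'.
have S_E x : x \in S <-> exists i, x = val (b i) \/ x = - val (b i).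
  split=> [xS|[i [->|->]]]; first exact: (S_b [` xS]).
    exact: valP.
  by have [y <-] := Nb_S i; exact: valP.
have f_sum (c : 'I_n -> R) i : f (b i) (\sum_j c j *: val (b j)) = c i.
  rewrite linear_sum (bigD1 i) //= linearZ /= fb eqxx mulr1.
  rewrite big1 ?addr0 // => j ji.
  by rewrite linearZ /= fb eq_sym (negbTE ji) mulr0.
exists (fun i => val (b i)); split=> // [e e1|c i]; last first.
  have := fle (b i) (\sum_j c j *: val (b j)).
  have := fle (b i) (- \sum_j c j *: val (b j)).
  by rewrite linearN f_sum is_normN // ler_norml lerNl => -> ->.
have e_sign i : e i = 1 \/ e i = -1.
  by have /eqP := e1 i; rewrite eqr_norml ler01 andbT => /orP[]/eqP; auto.
have eb_inj : injective (fun i => e i *: val (b i)).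
  move=> i j /(congr1 (f (b i))); rewrite !linearZ /= !fb eqxx.
  case: eqVneq => // _ /eqP; rewrite mulr1 mulr0 => /eqP ei.
  by have := e1 i; rewrite ei normr0 => /esym/eqP; rewrite oner_eq0.
exists [fset e i *: val (b i) | i in 'I_n].
  apply/fsubsetP => _ /imfsetP[i _ ->]; apply/S_E; exists i.
  by case: (e_sign i) => ->; [left; rewrite scale1r|right; rewrite scaleN1r].
by rewrite big_imfset /= ?enumT // => i j _ _; exact: eb_inj.
Qed.

(** L carries b to n unit vectors with signed sums of norm at most 1, hence to the standard basis up
    to order and signs; adding the opposites gives all of [pm_basis]. *)
Lemma extremal_isometry_image (L : {linear 'rV[R]_n -> 'rV[R]_n}) :
  linfty_isometry Phi L -> [fset L x | x in S] = pm_basis R n.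
Proof.
move=> [_ L_norm]; have [b [S_E b_sum _]] := extremal_cross.
have [||s [s_inj Lb]] := @unit_rows_signed_perm R n (fun i => L (b i)).
- by move=> i; rewrite L_norm S_unit //; apply/S_E; exists i; left.
- move=> e /b_sum[J JS bJ]; have := S_sum JS; rewrite -bJ -L_norm linear_sum.
  by under eq_bigr do rewrite linearZ.
have [s' _ s'K] := injF_bij s_inj.
apply/fsetP => y; apply/imfsetP/mem_pm_basis => [[x /S_E[i xi] ->]|[k yk]].
  by exists (s i); case: xi (Lb i) => -> [] Li; rewrite ?linearN Li ?opprK; auto.
case: (Lb (s' k)); rewrite s'K => Li; case: yk => ->.
- by exists (b (s' k)) => //; apply/S_E; exists (s' k); left.
- exists (- b (s' k)); rewrite ?linearN ?Li //.
  by apply/S_E; exists (s' k); right.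
- exists (- b (s' k)); rewrite ?linearN ?Li ?opprK //.
  by apply/S_E; exists (s' k); right.
- by exists (b (s' k)) => //; apply/S_E; exists (s' k); left.
Qed.

(** The isometry takes coordinates in the basis b: the norming functionals bound the maximum norm by
    [Phi], and convexity on the cube gives the converse. *)
Lemma extremal_isometry :
  exists L : {linear 'rV[R]_n -> 'rV[R]_n}, linfty_isometry Phi L.
Proof.
have [b [_ b_sum b_coord]] := extremal_cross.
have cube := norm_cube_le1 Phi_norm (b := b) _.
have {}cube : forall c : 'I_n -> R, (forall i, `|c i| <= 1) ->
    Phi (\sum_i c i *: b i) <= 1.
  by apply: cube => e /b_sum[J JS ->]; exact: S_sum.
pose B : 'M[R]_n := \matrix_i b i.
have mulB (u : 'rV[R]_n) : u *m B = \sum_i u 0 i *: b i.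
  by rewrite mulmx_sum_row; apply: eq_bigr => i _; rewrite rowK.
have Phi0 : Phi 0 = 0 by exact: (sublinear0 (is_norm_sublinear Phi_norm)).
have B_unit : B \in unitmx.
  rewrite -row_free_unit; apply: inj_row_free => u uB; apply/rowP => i.
  apply/eqP; rewrite mxE -normr_le0; apply: le_trans (b_coord (u 0) i) _.
  by rewrite -mulB uB Phi0.
have PhiB (u : 'rV[R]_n) : Phi (u *m B) = `|u|.
  apply/eqP; rewrite eq_le andbC row_norm_le ?is_norm_ge0 //=; last first.
    by move=> i; rewrite mulB; exact: (b_coord (u 0)).
  have [->|u0] := eqVneq u 0; first by rewrite mul0mx Phi0 normr0.
  have nu0 : 0 < `|u| by rewrite normr_gt0.
  have -> : u *m B = `|u| *: (\sum_i (u 0 i / `|u|) *: b i).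
    rewrite mulB scaler_sumr; apply: eq_bigr => i _.
    by rewrite scalerA mulrC divfK ?gt_eqF.
  rewrite is_norm_scale // normr_id ger_pMr // cube // => i.
  by rewrite normrM normfV normr_id ler_pdivrMr // mul1r coord_le_norm.
exists (mulmxr (invmx B)); split=> [|x] /=.
  by exists (mulmxr B) => x /=; rewrite ?mulmxKV ?mulmxK.
by rewrite -PhiB mulmxKV.
Qed.

End SmallSubsetSums.

Theorem theorem3 (R : realType) (n : nat) (n_gt0 : (1 <= n)%N)
    (Phi : 'rV[R]_n -> R) (Phi_norm : is_norm Phi)
    (S : {fset 'rV[R]_n})
    (S_unit : forall x, x \in S -> Phi x = 1)
    (S_sum : forall J : {fset 'rV[R]_n},
       J `<=` S -> Phi (\sum_(x <- J) x) <= 1) :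
  (#|` S| <= 2 * n)%N /\
  (#|` S| = (2 * n)%N <->
   (exists L : {linear 'rV[R]_n -> 'rV[R]_n}, linfty_isometry Phi L) /\
   (forall L : {linear 'rV[R]_n -> 'rV[R]_n}, linfty_isometry Phi L ->
      [fset L x | x in S] = pm_basis R n)).
Proof.
split; first exact: card_small_sums S_sum.
split=> [cardS|[[L L_iso] /(_ L L_iso) LS]]; last first.
  (* A single isometry suffices here: it is injective, so S has as many elements as its image. *)
  by rewrite -(card_pm_basis R) -LS card_imfset //; exact: bij_inj L_iso.1.
split; first exact: extremal_isometry cardS.
by move=> L; exact: extremal_isometry_image cardS L.
Qed.
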